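(* Assume that there are no faulty nodes. Then $\mathcal{L}_{\ell}\le 4\kappa(2+\log D)$ for all $\ell\in\mathbb{N}$.
   Context: $\mathbb{N}$ includes $0$; $\log=\log_2$. Graph. $(V,E)$ is a finite simple connected base graph of minimum degree at least $2$ and diameter $D\in\mathbb{N}_{>0}$. The layered graph $G=(V_G,E_G)$ has nodes $(v,\ell)$, $v\in V$, $\ell\in\mathbb{N}$ (layer $\ell$), and directed edges $((w,\ell),(v,\ell+1))$ whenever $w=v$ or $\{v,w\}\in E$. The predecessors of $(v,\ell)$, $\ell\ge1$, are the $(w,\ell-1)$ with $w=v$ or $\{v,w\}\in E$. Timing model. Reals $d$ (maximum delay), $0\le u\le d$ (delay uncertainty), $\vartheta>1$, $\Lambda$ are given. Each edge $e$ of $G$ has a fixed delay $\delta_e\in[d-u,d]$: a pulse sent along $e$ at time $t$ is received at time $t+\delta_e$. Each node has a hardware clock $H_{v,\ell}\colon\mathbb{R}_{\ge0}\to\mathbb{R}_{\ge0}$ with $t'-t\le H_{v,\ell}(t')-H_{v,\ell}(t)\le\vartheta(t'-t)$ for all $t<t'$, running at a constant rate. Algorithm. $t_{v,\ell}^k$ is the time of the $k$-th pulse of $(v,\ell)$, which is sent to all successors. For $\ell\ge1$ it is determined by the $k$-th pulses of the predecessors: let $h_w:=H_{v,\ell}(t_{w,\ell-1}^k+\delta_{((w,\ell-1),(v,\ell))})$, $H_{\mathrm{own}}:=h_v$, $H_{\min}:=\min_{\{v,w\}\in E}h_w$, $H_{\max}:=\max_{\{v,w\}\in E}h_w$, and $$\Delta:=\min_{s\in\mathbb{N}}\max\{H_{\mathrm{own}}-H_{\max}+4s\kappa,\;H_{\mathrm{own}}-H_{\min}-4s\kappa\}-\tfrac{\kappa}{2}.$$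 The correction is $\mathcal{C}_{v,\ell}:=\min\{H_{\mathrm{own}}-H_{\min}+\tfrac{3\kappa}{2},0\}$ if $\Delta<0$; $\mathcal{C}_{v,\ell}:=\Delta$ if $0\le\Delta\le\vartheta\kappa$; $\mathcal{C}_{v,\ell}:=\max\{H_{\mathrm{own}}-H_{\max}-\tfrac{3\kappa}{2},\vartheta\kappa\}$ if $\Delta>\vartheta\kappa$. The pulse time satisfies $H_{v,\ell}(t_{v,\ell}^k)=H_{\mathrm{own}}+\Lambda-d-\mathcal{C}_{v,\ell}$. Skew. $\mathcal{L}_{\ell}:=\sup_{k}\max_{\{v,w\}\in E}|t_{v,\ell}^k-t_{w,\ell}^k|$. Layer $0$ is given as input with $\mathcal{L}_0\le\kappa$. Parameters. $\kappa:=2\left(u+\left(1-\frac1\vartheta\right)(\Lambda-d)\right)>0$. For a sufficiently large absolute constant $C_0$: $\Lambda\ge C_0\vartheta(\sup_{\ell}\mathcal{L}_\ell+u)+d$, $d\ge C_0(\vartheta(\sup_\ell\mathcal{L}_\ell+u)+\kappa)$, and $d\ge C_0(u+(\vartheta-1)d)$. *)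

(* Defs.v *)
From HB Require Import structures.
From mathcomp Require Import all_boot all_order all_algebra.
From mathcomp Require Import all_classical all_reals all_analysis.

Set Implicit Arguments.
Unset Strict Implicit.
Unset Printing Implicit Defensive.

Import Order.TTheory GRing.Theory Num.Theory.
Import numFieldNormedType.Exports.

Local Open Scope classical_set_scope.
Local Open Scope ring_scope.

Section BaseGraph.
Variables (V : finType) (e : rel V).

(* Shortest paths have fewer than #|V| edges, so the bound on n is harmless;
   the value is #|V| when no path exists. *)
Definition gdist (x y : V) : nat :=
  \big[minn/#|V|]_(n < #|V| |
      [exists p : n.-tuple V, path e x p && (last x p == y)]) n.

Definition diameter : nat := \max_(p : V * V) gdist p.1 p.2.

(* Node (v, l) of the layered graph is the copy of v in layer l. *)
Definition layered_edge (x y : V * nat) : bool :=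
  (y.2 == x.2.+1) && ((x.1 == y.1) || e y.1 x.1).

End BaseGraph.

Section Algorithm.
Variable R : realType.

Definition log2 (x : R) : R := ln x / ln 2.

(* Clocks live on the nonnegative reals; values of H at negative arguments are
   irrelevant. *)
Definition hardware_clock (theta : R) (H : R -> R) : Prop :=
  [/\ forall t, 0 <= t -> 0 <= H t,
      forall t t', 0 <= t -> t < t' ->
        t' - t <= H t' - H t <= theta * (t' - t)
    & exists r : R, forall t t', 0 <= t -> 0 <= t' ->
        H t' - H t = r * (t' - t)].

Definition kappa (d u theta Lambda : R) : R :=
  2 * (u + (1 - theta^-1) * (Lambda - d)).

(* For k > 0 the infimum is a minimum: the first argument of the maximum is
   unbounded in s. *)
Definition Delta (k Hown Hmin Hmax : R) : R :=
  inf (range (fun s : nat =>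
    Num.max (Hown - Hmax + 4 * s%:R * k) (Hown - Hmin - 4 * s%:R * k)))
  - k / 2.

Definition correction (theta k Hown Hmin Hmax : R) : R :=
  let D := Delta k Hown Hmin Hmax in
  if D < 0 then Num.min (Hown - Hmin + 3 * k / 2) 0
  else if D <= theta * k then D
  else Num.max (Hown - Hmax - 3 * k / 2) (theta * k).

Variables (V : finType) (e : rel V).
Variables (delta : V * nat -> V * nat -> R) (H : V * nat -> R -> R).
(* t x k is the time of the k-th pulse of node x. *)
Variable t : V * nat -> nat -> R.

(* Local time at which (v, l.+1) receives the k-th pulse of (w, l). *)
Definition recv (k : nat) (v : V) (l : nat) (w : V) : R :=
  H (v, l.+1) (t (w, l) k + delta (w, l) (v, l.+1)).

(* Neighbourhoods are finite and, by the degree assumption, nonempty, so these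
   are a minimum and a maximum. *)
Definition recv_min (k : nat) (v : V) (l : nat) : R :=
  inf [set recv k v l w | w in [set w | e v w]].
Definition recv_max (k : nat) (v : V) (l : nat) : R :=
  sup [set recv k v l w | w in [set w | e v w]].

Definition follows_algorithm (d u theta Lambda : R) : Prop :=
  forall (v : V) (l k : nat),
    H (v, l.+1) (t (v, l.+1) k) =
    recv k v l v + Lambda - d
    - correction theta (kappa d u theta Lambda)
        (recv k v l v) (recv_min k v l) (recv_max k v l).

(* The supremum over all pulses may a priori be infinite. *)
Definition layer_skew (l : nat) : \bar R :=
  ereal_sup (range (fun k : nat =>
    (\big[Num.max/0]_(p : V * V | e p.1 p.2)
       `|t (p.1, l) k - t (p.2, l) k|)%:E)).

Definition sup_layer_skew : \bar R := ereal_sup (range layer_skew).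

End Algorithm.

(* Main.v *)
Require Import Defs.
From HB Require Import structures.
From mathcomp Require Import all_boot all_order all_algebra.
From mathcomp Require Import all_classical all_reals all_analysis.
From mathcomp Require Import ring lra zify.

(* Fix k and let a_l(v) be the k-th pulse time of (v, l), minus l * Lambda.
   Write Psi^s(l) for the maximum of a_l(v) - a_l(w) - 4 s kappa dist(v, w).
   Three facts bound Psi^s by about half of Psi^(s-1) for s >= 1; the same
   argument with the trivial bound dist <= D gives Psi^0 <= (4 D + 1) kappa.
   (1) Trailing nodes are fast: if x /= v maximises
   a_l(x) - (4s - 2) kappa dist(v, x), then the algorithm speeds x up by at
   least kappa, so this maximum drops by kappa per layer until only v
   itself matters.
   (2) Leading nodes are slow: if y /= w minimises
   a_l(y) + 4 s kappa dist(w, y), then y gets earlier by at most kappa / 2 per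
   layer.
   (3) A node becomes later only by jumping to 3/2 kappa before its earliest
   neighbour; since every node always has a neighbour at most 2 kappa later, it
   never becomes later than it once was by more than kappa / 2.
   Hence after n = Psi^(s-1) / kappa layers (1) and (3) make every v catch up
   with the earlier position of every w, while by (2) the leaders have moved by
   at most n kappa / 2. The additive errors sum to
   Psi^s <= (4 D / 2^s + 2) kappa, and s = floor(log D) gives the claim.
   The measurement errors fit into kappa: clock drift, over the lengths that
   matter, costs only a 1 / C0 fraction of kappa / 2 - u. *)

Set Implicit Arguments.
Unset Strict Implicit.
Unset Printing Implicit Defensive.

Import Order.TTheory GRing.Theory Num.Theory.
Import numFieldNormedType.Exports.

Local Open Scope ring_scope.

(** * Distance in the base graph *)

Section GraphDistance.
Variables (V : finType) (e : rel V).

Lemma bigminn_leq (n : nat) (P : pred 'I_n) (i : 'I_n) :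
  P i -> (\big[minn/n]_(j < n | P j) j <= i)%N.
Proof.
move=> Pi; elim: (index_enum _) (mem_index_enum i) => // j r IH.
rewrite inE big_cons => /orP[/eqP<-|/IH le]; first by rewrite Pi geq_minl.
by case: ifP => _ //; rewrite geq_min le orbT.
Qed.

(** The default [n] exceeds every index, so it cannot be the value once some index satisfies [P]. *)
Lemma bigminn_attained (n : nat) (P : pred 'I_n) :
  (exists i, P i) -> exists2 i : 'I_n, P i & \big[minn/n]_(j < n | P j) j = i.
Proof.
move=> [i0 Pi0].
have : (\big[minn/n]_(j < n | P j) j = n) \/
   exists2 i : 'I_n, P i & \big[minn/n]_(j < n | P j) j = i.
  elim/big_ind: _ => [|x y [->|[i Pi ->]] [->|[j Pj ->]]|i Pi].
  - by left.
  - by left; rewrite minnn.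
  - by right; exists j => //; apply/minn_idPr/ltnW.
  - by right; exists i => //; apply/minn_idPl/ltnW.
  - by right; rewrite /minn; case: ifP => _; [exists i | exists j].
  - by right; exists i.
by case=> // E; have := bigminn_leq Pi0; rewrite E leqNgt ltn_ord.
Qed.

Lemma gdist_leq_size (x : V) (p : seq V) :
  path e x p -> (gdist e x (last x p) <= size p)%N.
Proof.
move=> ep; case: (ltnP (size p) #|V|) => [ltpV | leVp].
  apply: (@bigminn_leq _ _ (Ordinal ltpV)).
  by apply/existsP; exists (in_tuple p); rewrite ep eqxx.
(* For a long walk the default suffices: [gdist] never exceeds [#|V|]. *)
apply: leq_trans leVp; rewrite /gdist.
elim/big_ind: _ => // [m n lem len|i _]; last exact/ltnW.
by rewrite geq_min lem.
Qed.

(** A path without repeated vertices is shorter than [#|V|], so connectivity rules out the default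
    value. *)
Lemma gdist_geodesic (x y : V) : connect e x y ->
  exists p, [/\ path e x p, last x p = y & size p = gdist e x y].
Proof.
move=> /connectP[p ep ->]; rewrite /gdist.
have [|i /existsP[q /andP[eq /eqP lq]] ->] := @bigminn_attained #|V|
    (fun n : 'I_#|V| =>
      [exists q : n.-tuple V, path e x q && (last x q == last x p)]).
  have [q eq uq _] := shortenP ep.
  have ltq : (size q < #|V|)%N.
    by rewrite -/(size (x :: q)) -(card_uniqP uq) max_card.
  by exists (Ordinal ltq); apply/existsP; exists (in_tuple q); rewrite eq eqxx.
by exists q; rewrite size_tuple.
Qed.

Hypothesis econn : forall v w : V, connect e v w.

Lemma gdistxx (x : V) : gdist e x x = 0%N.
Proof. by apply/eqP; rewrite -leqn0 (@gdist_leq_size x [::]). Qed.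

Lemma gdist_step (x y z : V) : e y z -> (gdist e x z <= (gdist e x y).+1)%N.
Proof.
have [p [ep <- <-]] := gdist_geodesic (econn x y) => eyz.
by have := @gdist_leq_size x (rcons p z); rewrite rcons_path ep eyz last_rcons
  size_rcons; apply.
Qed.

(** The witness is the last vertex but one of a geodesic. *)
Lemma gdist_closer (x y : V) : x != y ->
  exists2 q, e q y & (gdist e x q).+1 = gdist e x y.
Proof.
have [p [ep <- sp]] := gdist_geodesic (econn x y).
case/lastP: p ep sp => [|p z]; first by rewrite eqxx.
rewrite rcons_path last_rcons size_rcons => /andP[ep epz] sp _.
exists (last x p) => //; apply/eqP; rewrite eqn_leq gdist_step // andbT -sp.
by rewrite ltnS gdist_leq_size.
Qed.

Lemma gdist_edge (x y : V) : e x y -> (gdist e x y <= 1)%N.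
Proof. by rewrite -(gdistxx x); exact: gdist_step. Qed.

Lemma gdist_sym (x y : V) : symmetric e -> gdist e x y = gdist e y x.
Proof.
move=> esym; suff le u v : (gdist e u v <= gdist e v u)%N.
  by apply/eqP; rewrite eqn_leq !le.
have [p [ep lp <-]] := gdist_geodesic (econn v u).
have: path e u (rev (belast v p)).
  by rewrite -lp rev_path (eq_path (e' := e)) // => a b; exact: esym.
move=> /gdist_leq_size; rewrite size_rev size_belast.
case: p ep lp => [_ /= -> |w p _ _]; first by rewrite gdistxx.
by rewrite /= rev_cons last_rcons.
Qed.

Lemma gdist_le_diameter (x y : V) : (gdist e x y <= diameter e)%N.
Proof. by rewrite /diameter (leq_bigmax (x, y)). Qed.

End GraphDistance.

(** * Potentials *)

(* One layer, from pulse times a to b, both read modulo the nominal shift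
   Lambda. The slope 4 s + 2 of step_fast is (4 s' - 2) for s' = s + 1. *)
Record gradient_step (R : realType) (V : finType) (e : rel V) (kap : R)
    (a b : V -> R) : Prop := GradientStep {
  step_upper : forall v,
    b v <= a v \/ forall z, e v z -> b v <= a z - 3 / 2 * kap;
  step_lower : forall v,
    a v - 2 * kap <= b v \/ forall z, e v z -> a z + kap / 2 <= b v;
  step_ge_min : forall v, exists2 w, e v w & a w - 2 * kap <= b v;
  step_le_max : forall v, exists2 w, e v w & b v <= a w + 3 / 2 * kap;
  step_slow : forall (s : nat) v A, A <= a v ->
    (exists2 q, e v q & A + 4 * s%:R * kap <= a q) ->
    (forall z, e v z -> A - 4 * s%:R * kap <= a z) -> A - kap / 2 <= b v;
  step_fast : forall (s : nat) v A, a v <= A ->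
    (exists2 q, e v q & a q <= A - (4 * s%:R + 2) * kap) ->
    (forall z, e v z -> a z <= A + (4 * s%:R + 2) * kap) -> b v <= A - kap }.

Section Potentials.
Variables (R : realType) (V : finType) (e : rel V) (kap : R).
Variable a : nat -> V -> R.
Hypothesis esym : symmetric e.
Hypothesis econn : forall v w : V, connect e v w.
Hypothesis enbr : forall v : V, exists w, e v w.
Hypothesis kap_gt0 : 0 < kap.
Hypothesis a_step : forall l, gradient_step e kap (a l) (a l.+1).
Hypothesis a_init : forall v w, e v w -> a 0%N v - a 0%N w <= kap.

Local Notation dist v w := ((gdist e v w)%:R : R).

Lemma dist_step (v x y : V) : e x y -> dist v y <= dist v x + 1.
Proof. by move=> exy; rewrite /= natr1 ler_nat gdist_step. Qed.

Lemma dist_closer (v x : V) : v != x ->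
  exists2 q, e x q & dist v q = dist v x - 1.
Proof.
move=> /(gdist_closer econn)[q eqx dq]; exists q; first by rewrite esym.
by rewrite /= -dq -natr1; lra.
Qed.

Lemma dist_ge0 v x : 0 <= dist v x. Proof. exact: ler0n. Qed.

Lemma init_dist (v w : V) : a 0%N v - a 0%N w <= kap * dist w v.
Proof.
rewrite /=; have [n dn] : {n | gdist e w v = n} by exists (gdist e w v).
elim: n v dn => [|n IH] v dn.
  have [->|/(gdist_closer econn)[q _]] := eqVneq w v; last by rewrite dn.
  by rewrite gdistxx; lra.
have wv : w != v by apply/eqP => wv; move: dn; rewrite wv gdistxx.
have [q eqv] := gdist_closer econn wv.
rewrite dn => -[dq]; have := IH q dq; have := @a_init v q; rewrite esym eqv dq.
by move=> /(_ isT); rewrite -natr1; lra.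
Qed.

(* Jumps move a node next to its neighbours, so a node that is an isolated
   extremum of its neighbourhood cannot persist. *)
Lemma close_neighbours (l : nat) (v : V) :
  (exists2 z, e v z & a l z <= a l v + 2 * kap) /\
  (exists2 z, e v z & a l v - 4 * kap <= a l z).
Proof.
have k0 := kap_gt0; elim: l v => [|l IH] v.
  have [w evw] := enbr v; have := a_init evw.
  rewrite esym in evw; have := a_init evw; rewrite esym in evw.
  by split; exists w => //; lra.
(* Each half in layer [l.+1] uses the other half in layer [l], hence the joint induction. *)
have S := a_step l; split.
  have [w evw ?] := step_ge_min S v; exists w => //.
  have [?|/(_ v)] := step_upper S w; first by lra.
  rewrite esym => /(_ evw) ?.
  have [?|H] := step_lower S v; first by lra.
  by have [_ [z /H ? ?]] := IH v; lra.
have [w evw ?] := step_le_max S v; exists w => //.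
have [?|/(_ v)] := step_lower S w; first by lra.
rewrite esym => /(_ evw) ?.
have [?|H] := step_upper S v; first by lra.
by have [[z /H ? ?] _] := IH v; lra.
Qed.

(** Fact (3). The bounds on [v] and on one neighbour [z] sustain each other: a node that gets later
    lands [3 / 2 * kap] before the other one. *)
Lemma increase_bounded (l j : nat) (v : V) : a (l + j)%N v <= a l v + kap / 2.
Proof.
have k0 := kap_gt0; have [[z evz az] _] := close_neighbours l v.
suff [] : a (l + j)%N v <= a l v + kap / 2 /\ a (l + j)%N z <= a l v + 2 * kap.
  by [].
elim: j => [|j [IHv IHz]]; first by rewrite addn0; split; lra.
rewrite addnS; have S := a_step (l + j)%N; split.
  by have [?|/(_ _ evz) ?] := step_upper S v; lra.
by have [?|/(_ v)] := step_upper S z;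
  [lra | rewrite esym => /(_ evz); lra].
Qed.

(** This is Psi^s(l) <= B, stated without forming the maximum. *)
Definition potential_bounded (s l : nat) (B : R) :=
  forall v w, a l v - a l w - 4 * s%:R * kap * dist v w <= B.

(** Fact (1), for the parameter [s.+1] of the overview. The second argument of the maximum is the
    floor set by [v] itself. *)
Lemma trailing_decrease (s l j : nat) (v : V) (c : R) :
    (forall x, a l x <= c + (4 * s%:R + 2) * kap * dist v x) ->
  forall x, a (l + j)%N x <=
    Num.max (c - j%:R * kap) (a l v + kap / 2)
    + (4 * s%:R + 2) * kap * dist v x.
Proof.
have k0 := kap_gt0; move=> ac; have sk : 0 <= (4 * s%:R + 2) * kap :> R.
  by rewrite mulr_ge0 ?addr_ge0 ?mulr_ge0 ?ler0n // ltW.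
elim: j => [|j IH] x.
  by rewrite addn0 mul0r subr0 (le_trans (ac x)) // lerD2r le_max lexx.
(* At [v] no neighbour is closer to [v], so [step_fast] does not apply and fact (3) takes over. *)
have [<-|vx] := eqVneq v x.
  rewrite gdistxx mulr0 addr0 le_max; apply/orP; right; exact: increase_bounded.
rewrite addnS; set F := Num.max _ _ in IH.
apply: (@le_trans _ _ (F + (4 * s%:R + 2) * kap * dist v x - kap)).
  apply: (step_fast (s := s) (a_step (l + j)%N)) => //.
    have [q exq dq] := dist_closer vx; exists q => //.
    by have := IH q; rewrite dq; lra.
  move=> z exz; apply: le_trans (IH z) _.
  have := ler_wpM2l sk (dist_step v exz); lra.
rewrite addrAC lerD2r /F -[(j.+1)%:R]natr1.
rewrite maxEle; case: ifP => _; rewrite le_max; apply/orP.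
  by right; lra.
by left; lra.
Qed.

(** Fact (2). For positive [s] the node [v] has no neighbour closer to itself, so its own bound is a
    hypothesis. For [s = 0] the slope vanishes and any neighbour serves in [step_slow]. *)
Lemma leading_decrease (s l j : nat) (v : V) (c : R) :
    (forall y, c <= a l y + 4 * s%:R * kap * dist v y) ->
    ((0 < s)%N ->
      forall i, (i <= j)%N -> c - i%:R * (kap / 2) <= a (l + i)%N v) ->
  forall y, c - j%:R * (kap / 2) <= a (l + j)%N y + 4 * s%:R * kap * dist v y.
Proof.
have k0 := kap_gt0; move=> ca cv; have sk : 0 <= 4 * s%:R * kap :> R.
  by rewrite !mulr_ge0 ?ler0n // ltW.
elim: j cv => [|j IH] cv y; first by rewrite mul0r subr0 addn0.
have {}IH := IH (fun s0 i ij => cv s0 i (leqW ij)).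
have [vy|vy] := eqVneq v y; first have [s0|s0] := posnP s.
- rewrite s0 in IH *; rewrite mulr0 !mul0r addr0 addnS -natr1.
  set A := c - j%:R * (kap / 2) in IH *.
  have aA z : A <= a (l + j)%N z by have := IH z; rewrite mulr0 !mul0r addr0.
  have /= := step_slow (s := 0%N) (a_step (l + j)%N) (aA y).
  have [w eyw] := enbr y; rewrite !(mulr0, mul0r) addr0 subr0.
  move=> /(_ (ex_intro2 _ _ w eyw (aA w)) (fun z _ => aA z)).
  by rewrite /A; lra.
- by rewrite -vy gdistxx mulr0 addr0 cv.
rewrite addnS; set A := c - j%:R * (kap / 2) in IH *.
have H : A - 4 * s%:R * kap * dist v y - kap / 2 <= a (l + j).+1 y.
  apply: (step_slow (s := s) (a_step (l + j)%N)).
  - by have := IH y; lra.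
  - have [q eyq dq] := dist_closer vy; exists q => //.
    by have := IH q; rewrite dq; lra.
  - move=> z eyz; have := IH z; have := ler_wpM2l sk (dist_step v eyz).
    by lra.
by move: H; rewrite /A -[(j.+1)%:R]natr1 /=; lra.
Qed.

(** The [n] layers absorb [B] at a rate of [kap] per layer. If fewer than [n] layers precede,
    [l - n] is [0], where the initial skew has slope at most [kap] and nothing needs to be absorbed.
    The guard [n <= l] lets a strong induction on [l] supply the potential bound. *)
Lemma catch_up (s l n : nat) (B : R) :
    ((n <= l)%N -> potential_bounded s (l - n) B) -> B <= n%:R * kap ->
  forall v y,
    a l v <= a (l - n)%N y + kap / 2 + (4 * s%:R + 2) * kap * dist y v.
Proof.
move=> pb Bn v y; have k0 := ltW kap_gt0.
have [nl|/ltnW ln] := leqP n l.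
  have /(@trailing_decrease s (l - n) n y) : forall x,
      a (l - n)%N x <= a (l - n)%N y + B + (4 * s%:R + 2) * kap * dist y x.
    move=> x; have := pb nl x y; rewrite (gdist_sym econn x y) //=.
    by have := mulr_ge0 k0 (dist_ge0 y x); lra.
  move=> /(_ v); rewrite subnK // => /le_trans; apply; rewrite lerD2r.
  by rewrite ge_max lexx andbT; lra.
move: ln; rewrite -subn_eq0 => /eqP ->.
have /(@trailing_decrease s 0 l y) : forall x,
      a 0%N x <= a 0%N y + (4 * s%:R + 2) * kap * dist y x.
  move=> x; have := init_dist x y; have := mulr_ge0 k0 (dist_ge0 y x).
  have s0 : 0 <= s%:R :> R by [].
  move=> kd0; have := mulr_ge0 s0 kd0; lra.
move=> /(_ v); rewrite add0n => /le_trans; apply; rewrite lerD2r.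
rewrite ge_max lexx andbT; have := mulr_ge0 (ler0n R l) k0; lra.
Qed.

Lemma potential0_bounded (l : nat) :
  potential_bounded 0 l ((4 * (diameter e)%:R + 1) * kap).
Proof.
have k0 := kap_gt0; set D := diameter e.
have nD : (4 * D + 1)%:R = 4 * D%:R + 1 :> R by rewrite natrD natrM.
elim/ltn_ind: l => l IH v w; rewrite mulr0 !mul0r subr0.
(* With [B = (4 * D + 1) * kap] this is [B / kap]. Catching up costs [(2 * D + 1 / 2) * kap] and the
   leaders lose [B / 2], which add up to [B] again. *)
set n := (4 * D + 1)%N; pose c := a l v - kap / 2 - 2 * kap * D%:R.
have cu y : c <= a (l - n)%N y.
  have : a l v <= a (l - n)%N y + kap / 2 + (4 * 0%:R + 2) * kap * dist y v.
    apply: (@catch_up 0 l n ((4 * D%:R + 1) * kap)); last by rewrite /n nD.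
    by move=> nl; apply: IH; rewrite /n; lia.
  have : dist y v <= D%:R by rewrite ler_nat gdist_le_diameter.
  have /ler_wpM2l h : 0 <= 2 * kap by rewrite mulr_ge0 // ltW.
  by move=> /h; rewrite /c /= mulr0 add0r; lra.
have En : n%:R * kap = (4 * D%:R + 1) * kap by rewrite /n nD.
have El : ((l - n) + minn n l)%N = l by lia.
have nk : (minn n l)%:R * kap <= n%:R * kap.
  by apply: ler_wpM2r; [exact: ltW | rewrite ler_nat geq_minl].
have := @leading_decrease 0 (l - n) (minn n l) v c _ _ w.
rewrite El mulr0 !mul0r addr0 => H.
have : c - (minn n l)%:R * (kap / 2) <= a l w.
  by apply: H => // y; rewrite mul0r addr0.
by rewrite /c; lra.
Qed.

(** Catching up costs [kap / 2] and takes [n] layers, in which the leaders lose [n * kap / 2], at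
    most [(B + kap) / 2]. The slope [4 * s + 2] of the trailing nodes is below the new slope
    [4 * s.+1]. *)
Lemma potential_halving (s : nat) (B : R) :
    (forall l, potential_bounded s l B) ->
  forall l, potential_bounded s.+1 l (B / 2 + kap).
Proof.
have k0 := kap_gt0; move=> pb l v w.
have B0 : 0 <= B by have := pb l v v; rewrite gdistxx; lra.
pose n := (Num.truncn (B / kap)).+1.
have Bn : B <= n%:R * kap.
  by rewrite -ler_pdivrMr //; apply/ltW/truncnS_gt.
have nB : n%:R * kap <= B + kap.
  have : (Num.truncn (B / kap))%:R <= B / kap.
    by rewrite truncn_le; apply: divr_ge0; last exact: ltW.
  by rewrite ler_pdivlMr // /n -natr1; lra.
pose c := a l v - kap / 2.
have El : ((l - n) + minn n l)%N = l by lia.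
have nk : (minn n l)%:R * kap <= n%:R * kap.
  by apply: ler_wpM2r; [exact: ltW | rewrite ler_nat geq_minl].
have := @leading_decrease s.+1 (l - n) (minn n l) v c _ _ w.
rewrite El => H.
suff : c - (minn n l)%:R * (kap / 2) <= a l w + 4 * s.+1%:R * kap * dist v w.
  by rewrite /c; lra.
apply: H => [y|_ i il].
  have := catch_up (fun _ => pb (l - n)%N) Bn v y.
  rewrite /c (gdist_sym econn y v) // -natr1.
  by have := mulr_ge0 (ltW k0) (dist_ge0 v y); lra.
(* Fact (3) read backwards: the position of [v] in layer [l] bounds its earlier positions from
   below. *)
have := increase_bounded (l - n + i) (minn n l - i) v.
have -> : (l - n + i + (minn n l - i))%N = l by lia.
by have := mulr_ge0 (ler0n R i) (ltW k0); rewrite /c; lra.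
Qed.

(** The additive term [2 * kap] is the fixed point of [B / 2 + kap]. *)
Lemma potential_decay (s l : nat) :
  potential_bounded s l ((4 * (diameter e)%:R / 2 ^+ s + 2) * kap).
Proof.
have k0 := kap_gt0; elim: s l => [|s IH] l v w.
  by have := potential0_bounded l v w; rewrite expr0 divr1; lra.
apply: le_trans (potential_halving IH l v w) _.
by rewrite exprS invfM; lra.
Qed.

Lemma neighbour_skew (s l : nat) (v w : V) : e v w ->
  a l v - a l w <= 4 * kap * ((diameter e)%:R / 2 ^+ s + s%:R + 1 / 2).
Proof.
move=> evw; have := potential_decay s l v w.
have : dist v w <= 1 by rewrite lern1 gdist_edge.
have /ler_wpM2l h : 0 <= 4 * s%:R * kap.
  by rewrite !mulr_ge0 ?ler0n // ltW.
by move=> /h; lra.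
Qed.

End Potentials.

(** * The correction of a single node *)

Section Correction.
Variables (R : realType) (theta k Hown Hmin Hmax : R).
Hypothesis k_gt0 : 0 < k.
Hypothesis Hmin_le_max : Hmin <= Hmax.
Local Notation al := (Hown - Hmax).
Local Notation be := (Hown - Hmin).
Local Notation C := (correction theta k Hown Hmin Hmax).

Lemma Delta_le (s : nat) :
  Delta k Hown Hmin Hmax <=
  Num.max (al + 4 * s%:R * k) (be - 4 * s%:R * k) - k / 2.
Proof.
rewrite /Delta lerD2r; apply: ge_inf; last by exists s.
exists al => _ [n _ <-]; rewrite le_max lerDl.
by rewrite !mulr_ge0 ?ler0n // ltW.
Qed.

Lemma Delta_ge (m : R) :
  (forall s : nat, m <= Num.max (al + 4 * s%:R * k) (be - 4 * s%:R * k)) ->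
  m - k / 2 <= Delta k Hown Hmin Hmax.
Proof.
move=> H; rewrite /Delta lerD2r; apply: lb_le_inf; first by eexists; exists 0%N.
by move=> _ [n _ <-].
Qed.

Lemma Delta_le_own_min : Delta k Hown Hmin Hmax <= be - k / 2.
Proof.
have := Delta_le 0; rewrite mulr0 mul0r addr0 subr0 max_r //.
by rewrite lerD2l lerN2 Hmin_le_max.
Qed.

Lemma Delta_ge_own_max : al - k / 2 <= Delta k Hown Hmin Hmax.
Proof.
apply: Delta_ge => s; rewrite le_max lerDl.
by rewrite !mulr_ge0 ?ler0n // ltW.
Qed.

Hypothesis theta_ge1 : 1 <= theta.

Lemma correction_le : C <= be + 3 / 2 * k.
Proof.
have ? := Delta_le_own_min; have ? := Hmin_le_max; have k0 := k_gt0.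
have ? := ler_wpM2r (ltW k_gt0) theta_ge1.
rewrite /correction; case: (ltP _ 0) => ?.
  by rewrite ge_min; apply/orP; left; lra.
case: (leP (Delta _ _ _ _)) => ?; first by lra.
by rewrite ge_max; apply/andP; split; lra.
Qed.

Lemma correction_ge : al - 3 / 2 * k <= C.
Proof.
have ? := Delta_ge_own_max; have ? := Hmin_le_max; have k0 := k_gt0.
rewrite /correction; case: (ltP _ 0) => ?.
  by rewrite le_min; apply/andP; split; lra.
case: (leP (Delta _ _ _ _)) => ?; first by lra.
by rewrite le_max; apply/orP; left; lra.
Qed.

(** Only the branch of negative [Delta] can yield a negative value, and then the minimum with [0] is
    its first argument. *)
Lemma correction_ge0_or_jump : 0 <= C \/ C = be + 3 / 2 * k.
Proof.
have k0 := k_gt0; have ? := ler_wpM2r (ltW k_gt0) theta_ge1.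
rewrite /correction; case: (ltP _ 0) => ?.
  by case: (leP (be + 3 * k / 2)) => ?; [right | left]; lra.
left; case: (leP (Delta _ _ _ _)) => // ?.
by rewrite le_max; apply/orP; right; lra.
Qed.

Lemma correction_le_or_jump : C <= theta * k \/ C = al - 3 / 2 * k.
Proof.
have k0 := k_gt0; have ? := ler_wpM2r (ltW k_gt0) theta_ge1.
rewrite /correction; case: (ltP _ 0) => ?.
  by left; rewrite ge_min; apply/orP; right; lra.
case: (leP (Delta _ _ _ _)) => ?; first by left.
by case: (leP (al - 3 * k / 2)) => ?; [left | right]; lra.
Qed.

(** For fact (2). In the branch [Delta > theta * k], the value is either the jump or [theta * k],
    which is still below [Delta]. *)
Lemma correction_slow (s : nat) :
  [\/ C <= 0,
      C <= Num.max (al + 4 * s%:R * k) (be - 4 * s%:R * k) - k / 2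
    | C = al - 3 / 2 * k].
Proof.
have DM := Delta_le s; rewrite /correction; case: (ltP _ 0) => D0.
  by apply: Or31; rewrite ge_min lexx orbT.
case: (leP (Delta _ _ _ _)) => Dk; first exact: Or32.
by case: (leP (al - 3 * k / 2)) => ?; [apply: Or32 | apply: Or33]; lra.
Qed.

(** For fact (1). A uniform lower bound on the terms bounds [Delta] from below, and the three cases
    follow the branches of the correction. *)
Lemma correction_fast (m : R) :
  (forall s : nat, m <= Num.max (al + 4 * s%:R * k) (be - 4 * s%:R * k)) ->
  [\/ m < k / 2, m - k / 2 <= C <= theta * k | theta * k <= C].
Proof.
move=> /Delta_ge mD; rewrite /correction; case: (ltP _ 0) => D0.
  by apply: Or31; lra.
case: (leP (Delta _ _ _ _)) => Dk; first by apply: Or32; rewrite mD.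
by apply: Or33; rewrite le_max lexx orbT.
Qed.

End Correction.

(* y w is the real time at which the pulse of w arrives at v, minus d and the
   nominal shift; r is the rate of the clock of v, and eps is the part of
   Lambda - d that v skips because of r. By nu_eps_drift a jump of 3/2 kap in
   local time still reaches 3/2 kap in real time. *)
Record node_update (R : realType) (V : finType) (e : rel V) (kap theta u : R)
    (a : V -> R) (b : R) (v : V) (r eps : R) (y : V -> R) (wmin wmax : V)
    : Prop := NodeUpdate {
  nu_kap : 0 < kap;
  nu_u : 0 <= u;
  nu_r : 1 <= r <= theta;
  nu_theta : theta <= 1 + 1 / 16;
  nu_eps : 0 <= eps /\ u + eps <= kap / 2;
  nu_eps_drift : 3 / 2 * kap * (1 - r^-1) <= eps;
  nu_arrival : forall w, (w == v) || e v w -> a w - u <= y w <= a w;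
  nu_drift : forall w, e v w -> `|(r - 1) * (y v - y w)| <= kap / 4;
  nu_min : e v wmin /\ forall w, e v w -> y wmin <= y w;
  nu_max : e v wmax /\ forall w, e v w -> y w <= y wmax;
  nu_time : b = y v - eps -
    correction theta kap (r * y v) (r * y wmin) (r * y wmax) / r }.

(** * Real-time effect of one correction *)

Section NodeUpdate.
Variables (R : realType) (V : finType) (e : rel V) (kap theta u : R).
Variables (a : V -> R) (b : R) (v : V) (r eps : R) (y : V -> R) (wmin wmax : V).
Hypothesis nu : node_update e kap theta u a b v r eps y wmin wmax.

Local Notation C :=
  (correction theta kap (r * y v) (r * y wmin) (r * y wmax)).

Lemma nu_r_gt0 : 0 < r.
Proof. by have [_ _ /andP[r1 _] _ _ _ _ _ _ _ _] := nu; lra. Qed.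

Lemma nu_kap_r : 16 / 17 * kap <= kap / r <= kap.
Proof.
have [k0 _ /andP[r1 rt] tt _ _ _ _ _ _ _] := nu; have r0 := nu_r_gt0.
rewrite ler_pdivlMr // ler_pdivrMr // ler_peMr ?(ltW k0) // andbT.
have /(ler_wpM2l (ltW k0)) : r <= 17 / 16 by lra.
by lra.
Qed.

(** A local correction of [theta * kap] is worth at least [kap] in real time at every admissible
    rate. *)
Lemma nu_theta_kap_r : kap <= theta * kap / r <= 17 / 16 * kap.
Proof.
have [k0 _ /andP[r1 rt] tt _ _ _ _ _ _ _] := nu; have r0 := nu_r_gt0.
rewrite ler_pdivlMr // ler_pdivrMr // mulrC ler_wpM2r ?(ltW k0) //=.
rewrite [17 / 16 * _]mulrC -mulrA mulrC ler_wpM2l ?(ltW k0) //.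
nra.
Qed.

Lemma nu_min_le_max : r * y wmin <= r * y wmax.
Proof.
have [_ _ _ _ _ _ _ _ [emin _] [_ H] _] := nu.
by rewrite ler_wpM2l ?(ltW nu_r_gt0) // H.
Qed.

Lemma divr_le (x z : R) : x <= z -> x / r <= z / r.
Proof. by move=> xz; rewrite ler_wpM2r // invr_ge0 ltW // nu_r_gt0. Qed.

Lemma nu_diff (w : V) (c : R) :
  (r * y v - r * y w + c) / r = y v - y w + c / r.
Proof. by field; rewrite gt_eqF // nu_r_gt0. Qed.

Lemma nu_diffB (w : V) (c : R) :
  (r * y v - r * y w - c) / r = y v - y w - c / r.
Proof. by rewrite nu_diff mulNr. Qed.

Lemma nu_arrival_own : a v - u <= y v <= a v.
Proof. by have [_ _ _ _ _ _ ya _ _ _ _] := nu; rewrite ya ?eqxx. Qed.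

Lemma nu_arrival_nbr (w : V) : e v w -> a w - u <= y w <= a w.
Proof.
by move=> ew; have [_ _ _ _ _ _ ya _ _ _ _] := nu; rewrite ya ?ew ?orbT.
Qed.

Lemma nu_drift_nbr (w : V) : e v w ->
  y v - y w - kap / 4 <= r * y v - r * y w <= y v - y w + kap / 4.
Proof.
have [_ _ _ _ _ _ _ dr _ _ _] := nu => /dr; rewrite ler_norml => /andP[h1 h2].
by apply/andP; split; lra.
Qed.

Lemma node_upper : b <= a v \/ forall z, e v z -> b <= a z - 3 / 2 * kap.
Proof.
have [k0 u0 /andP[r1 rt] tt [e0 e1] e2 ya dr [emin ymin] [emax ymax] ->] := nu.
have /andP[yv1 yv2] := nu_arrival_own; have r0 := nu_r_gt0.
have [C0|->] := correction_ge0_or_jump (r * y v) (r * y wmin)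
  (r * y wmax) k0 (le_trans r1 rt); [left | right].
  have : 0 <= C / r by rewrite divr_ge0 // ltW.
  by lra.
move=> z ez; rewrite nu_diff.
have /andP[yz1 yz2] := nu_arrival_nbr ez.
by have := ymin z ez; lra.
Qed.

Lemma node_lower : a v - 2 * kap <= b \/ forall z, e v z -> a z + kap / 2 <= b.
Proof.
have [k0 u0 /andP[r1 rt] tt [e0 e1] e2 ya dr [emin ymin] [emax ymax] ->] := nu.
have /andP[yv1 yv2] := nu_arrival_own.
have /andP[kr1 kr2] := nu_kap_r; have /andP[tr1 tr2] := nu_theta_kap_r.
have [/divr_le h|->] := correction_le_or_jump (r * y v) (r * y wmin)
  (r * y wmax) k0 (le_trans r1 rt); [left; lra | right => z ez].
rewrite nu_diffB; have /andP[yz1 yz2] := nu_arrival_nbr ez.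
by have := ymax z ez; lra.
Qed.

Lemma node_ge_min : exists2 w, e v w & a w - 2 * kap <= b.
Proof.
have [k0 u0 /andP[r1 rt] tt [e0 e1] e2 ya dr [emin ymin] [emax ymax] ->] := nu.
exists wmin => //; have /andP[yz1 yz2] := nu_arrival_nbr emin.
have /andP[kr1 kr2] := nu_kap_r.
have /divr_le := correction_le (r * y v) k0 nu_min_le_max (le_trans r1 rt).
by rewrite nu_diff; lra.
Qed.

Lemma node_le_max : exists2 w, e v w & b <= a w + 3 / 2 * kap.
Proof.
have [k0 u0 /andP[r1 rt] tt [e0 e1] e2 ya dr [emin ymin] [emax ymax] ->] := nu.
exists wmax => //; have /andP[yz1 yz2] := nu_arrival_nbr emax.
have /andP[kr1 kr2] := nu_kap_r.
have /divr_le := correction_ge theta (r * y v) k0 nu_min_le_max.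
by rewrite nu_diffB; lra.
Qed.

(** The neighbour [q] controls the first argument of the maximum for this [s], the lower bound on
    all neighbours the second. Both are at most [y v - A + u + kap / 4], where [kap / 4] is clock
    drift. *)
Lemma node_slow (s : nat) (A : R) : A <= a v ->
    (exists2 q, e v q & A + 4 * s%:R * kap <= a q) ->
    (forall z, e v z -> A - 4 * s%:R * kap <= a z) ->
  A - kap / 2 <= b.
Proof.
have [k0 u0 /andP[r1 rt] tt [e0 e1] e2 ya dr [emin ymin] [emax ymax] ->] := nu.
move=> Av [q evq Aq] /(_ _ emin) Amin.
have /andP[yv1 yv2] := nu_arrival_own.
have /andP[yq1 yq2] := nu_arrival_nbr evq; have yqm := ymax q evq.
have /andP[ym1 ym2] := nu_arrival_nbr emin.
have /andP[kr1 kr2] := nu_kap_r.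
have /andP[dmin1 dmin2] := nu_drift_nbr emin.
have /andP[dmax1 dmax2] := nu_drift_nbr emax.
have sk : 0 <= s%:R * kap by rewrite mulr_ge0 // ltW.
have [/divr_le|C_le|->] :=
  correction_slow theta (r * y v) (r * y wmin) (r * y wmax) k0 s.
- by rewrite mul0r; lra.
- have {}C_le : C <= y v - A + u - kap / 4.
    apply: le_trans C_le _; rewrite lerBlDr ge_max; apply/andP; split; lra.
  have [C0|/ltW/divr_le] := leP 0 C; last by rewrite mul0r; lra.
  have : C / r <= C by rewrite ler_pdivrMr ?nu_r_gt0 // ler_peMr.
  by lra.
- by rewrite nu_diffB; lra.
Qed.

Lemma node_fast (s : nat) (A : R) : a v <= A ->
    (exists2 q, e v q & a q <= A - (4 * s%:R + 2) * kap) ->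
    (forall z, e v z -> a z <= A + (4 * s%:R + 2) * kap) ->
  b <= A - kap.
Proof.
have [k0 u0 /andP[r1 rt] tt [e0 e1] e2 ya dr [emin ymin] [emax ymax] ->] := nu.
move=> Av [q evq Aq] /(_ _ emax) Amax; have r0 := nu_r_gt0.
have /andP[yv1 yv2] := nu_arrival_own.
have /andP[yq1 yq2] := nu_arrival_nbr evq; have yqm := ymin q evq.
have /andP[ym1 ym2] := nu_arrival_nbr emax.
have /andP[kr1 kr2] := nu_kap_r; have /andP[tr1 tr2] := nu_theta_kap_r.
have /andP[dmin1 dmin2] := nu_drift_nbr emin.
have /andP[dmax1 dmax2] := nu_drift_nbr emax.
have sk : 0 <= s%:R * kap by rewrite mulr_ge0 // ltW.
have [C0|->] := correction_ge0_or_jump (r * y v) (r * y wmin)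
  (r * y wmax) k0 (le_trans r1 rt); last by rewrite nu_diff; lra.
have Cr : 0 <= C / r by rewrite divr_ge0 // ltW.
(* The slope [4 * s + 2] lies midway between [4 * s] and [4 * s.+1]. Terms with [i <= s] are large
   because of [q], later ones because of the bound on all neighbours, with margin [2 * kap] less
   [kap / 4] of drift. *)
have [i||/andP[mC Ct]|/divr_le] := @correction_fast R theta kap (r * y v)
  (r * y wmin) (r * y wmax) (7 / 4 * kap + y v - A).
- rewrite le_max; have [is_|si] := leqP i s; apply/orP; [right | left].
    have /(ler_wpM2r (ltW k0)) : i%:R <= s%:R :> R by rewrite ler_nat.
    by lra.
  have /(ler_wpM2r (ltW k0)) : s.+1%:R <= i%:R :> R by rewrite ler_nat.
  by rewrite -natr1; lra.
- by lra.
(* Here [C] is at least [5 / 4 * kap + y v - A], and the surplus [kap / 4] pays for the division by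
   [r]. *)
- have : C <= 17 / 16 * (C / r).
    have /(ler_wpM2r Cr) : r <= 17 / 16 by lra.
    by rewrite mulrC divfK // gt_eqF.
  have : theta * kap <= 17 / 16 * kap by rewrite ler_wpM2r ?(ltW k0) //; lra.
  by lra.
- by lra.
Qed.

End NodeUpdate.

(** * From the algorithm to the potentials *)

Lemma correction_shift (R : realType) (theta k c x y z : R) :
  correction theta k (c + x) (c + y) (c + z) = correction theta k x y z.
Proof.
have E p q : c + p - (c + q) = p - q by ring.
by rewrite /correction /Delta !E.
Qed.

Lemma inf_attained (R : realType) (A : set R) (m : R) :
  A m -> lbound A m -> inf A = m.
Proof.
move=> Am lb; apply/eqP; rewrite eq_le ge_inf ?lb_le_inf //; last by exists m.
by exists m.
Qed.

Lemma sup_attained (R : realType) (A : set R) (m : R) :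
  A m -> ubound A m -> sup A = m.
Proof.
move=> Am ub; apply/eqP; rewrite eq_le ge_sup ?ub_le_sup //; last by exists m.
by exists m.
Qed.

Lemma gradient_step_nodes (R : realType) (V : finType) (e : rel V)
    (kap theta u : R) (a b : V -> R) :
  (forall v, exists r eps y wmin wmax,
    node_update e kap theta u a (b v) v r eps y wmin wmax) ->
  gradient_step e kap a b.
Proof.
move=> H; split=> [v|v|v|v|s v|s v]; have [r [eps [y [w1 [w2 nu]]]]] := H v.
- exact: node_upper nu.
- exact: node_lower nu.
- exact: node_ge_min nu.
- exact: node_le_max nu.
- exact: node_slow nu s.
- exact: node_fast nu s.
Qed.

(** Since [ln 2 <= 1], the chain is [log2 x >= ln x >= 1 - 1 / x >= x - 3 / 2]. *)
Lemma log2_ge (R : realType) (x : R) : 1 <= x <= 2 -> x - 3 / 2 <= log2 x.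
Proof.
move=> /andP[x1 x2]; have x0 : 0 < x by lra.
have ln2 : 0 < ln 2 :> R by apply: ln_gt0; lra.
have ln2_le1 : ln 2 <= 1 :> R.
  by have := @le_ln1Dx R 1; rewrite -[1 + 1]/2; apply; lra.
have lnx : 0 <= ln x by apply: ln_ge0.
have x10 : 0 < x^-1 by rewrite invr_gt0.
have h : 1 - x^-1 <= ln x.
  have : ln (1 + (x^-1 - 1)) <= x^-1 - 1 by apply: le_ln1Dx; lra.
  by rewrite addrC subrK lnV //; lra.
apply: (@le_trans _ _ (ln x)); last by rewrite ler_pdivlMr // ler_piMr.
(* This quotient is the difference of the two sides. *)
apply: le_trans h; have : 0 <= (2 - x) * (x - 1 / 2) / x.
  by apply: divr_ge0; [apply: mulr_ge0; lra | exact: ltW].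
have -> : (2 - x) * (x - 1 / 2) / x = 5 / 2 - x - x^-1.
  by field; rewrite gt_eqF.
by lra.
Qed.

(** For [s = floor(log D)] the quotient [D / 2 ^ s] lies between 1 and 2, where [log2_ge]
    applies. *)
Lemma log2_levels (R : realType) (D : nat) : (0 < D)%N ->
  exists s : nat, D%:R / 2 ^+ s + s%:R + 1 / 2 <= 2 + log2 D%:R :> R.
Proof.
move=> D0; exists (trunc_log 2 D); set s := trunc_log 2 D.
have s1 : (2 ^ s <= D)%N by rewrite trunc_logP.
have s2 : (D < 2 ^ s.+1)%N by rewrite trunc_log_ltn.
have p0 : 0 < 2 ^+ s :> R by rewrite exprn_gt0.
have : 1 <= D%:R / 2 ^+ s :> R /\ D%:R / 2 ^+ s <= 2 :> R.
  rewrite ler_pdivlMr // ler_pdivrMr // mul1r -exprS -!natrX !ler_nat s1.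
  by split=> //; exact: ltnW.
move=> /andP/log2_ge.
have ln2 : 0 < ln 2 :> R by apply: ln_gt0; lra.
have -> : log2 (D%:R / 2 ^+ s) = log2 D%:R - s%:R :> R.
  rewrite /log2 ln_div ?posrE ?ltr0n // lnXn // mulrBl -[ln 2 *+ s]mulr_natl.
  by rewrite mulfK // gt_eqF.
by lra.
Qed.

Section Execution.
Variables (R : realType) (V : finType) (e : rel V) (d u theta Lambda L : R).
Variables (delta : V * nat -> V * nat -> R) (H : V * nat -> R -> R).
Variables (t : V * nat -> nat -> R) (k l : nat).
Hypothesis enbr : forall v : V, exists w, e v w.
Hypothesis u_ge0 : 0 <= u.
Hypothesis u_le_d : u <= d.
Hypothesis theta_gt1 : 1 < theta.
Hypothesis delta_bounds :
  forall x y : V * nat, layered_edge e x y -> d - u <= delta x y <= d.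
Hypothesis clock : forall x : V * nat, hardware_clock theta (H x).
Hypothesis t_ge0 : forall (x : V * nat) (k : nat), 0 <= t x k.
Hypothesis algo : follows_algorithm e delta H t d u theta Lambda.
Local Notation kap := (kappa d u theta Lambda).
Hypothesis kap_gt0 : 0 < kap.
Hypothesis L_bound : forall v w, e v w -> `|t (v, l) k - t (w, l) k| <= L.
Hypothesis L_ge0 : 0 <= L.
Hypothesis Lambda_ge : 32 * (theta * (L + u)) + d <= Lambda.
Hypothesis d_ge : 32 * kap <= d.
Hypothesis d_ge_drift : 32 * ((theta - 1) * d) <= d.

Lemma theta_le : theta <= 1 + 1 / 32.
Proof.
have k0 := kap_gt0; have h := d_ge; have h2 := d_ge_drift.
have d0 : 0 < d by lra.
rewrite -(ler_pM2r d0); lra.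
Qed.

Lemma Lambda_sub_ge : 32 * (L + u) <= Lambda - d.
Proof.
have h := Lambda_ge; have h0 := L_ge0; have h1 := u_ge0.
have /ler_wpM2r : 1 <= theta by apply: ltW.
by move=> /(_ (L + u)); rewrite mul1r; lra.
Qed.

Lemma kappa_half : kap / 2 = u + (1 - theta^-1) * (Lambda - d).
Proof. by rewrite /kappa; field; rewrite gt_eqF // (lt_trans ltr01). Qed.

Lemma inv_drift_le : 1 - theta^-1 <= theta - 1.
Proof.
have t1 := theta_gt1; have t0 : 0 < theta by lra.
have : 0 <= (theta - 1) ^+ 2 / theta by rewrite divr_ge0 ?sqr_ge0 // ltW.
have -> : (theta - 1) ^+ 2 / theta = theta - 2 + theta^-1.
  by field; rewrite gt_eqF.
by lra.
Qed.

Lemma inv_drift_ge0 : 0 <= 1 - theta^-1.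
Proof. by rewrite subr_ge0 invf_le1 ?ltW // (lt_trans ltr01). Qed.

(** The lower bound on [Lambda - d] makes [32 * ((theta - 1) * (L + u))] at most [kap / 2 - u]. *)
Lemma drift_skew : (theta - 1) * (L + u) <= kap / 4.
Proof.
have t1 := theta_gt1; have t0 : 0 < theta by lra.
have h : 32 * (theta * (L + u)) <= Lambda - d by have := Lambda_ge; lra.
have := ler_wpM2l inv_drift_ge0 h; have := kappa_half; have := u_ge0.
have -> : (1 - theta^-1) * (32 * (theta * (L + u))) =
    32 * ((theta - 1) * (L + u)).
  by field; rewrite gt_eqF.
have : 0 <= (theta - 1) * (L + u).
  by apply: mulr_ge0; [lra | apply: addr_ge0].
by lra.
Qed.

Lemma kappa_le : 3 / 2 * kap <= Lambda - d.
Proof.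
have h := Lambda_sub_ge; have h1 := u_ge0; have h2 := L_ge0.
have h3 := inv_drift_le; have h4 := theta_le; have h5 := kappa_half.
have Ld : 0 <= Lambda - d by lra.
have /(ler_wpM2r Ld) : 1 - theta^-1 <= 1 / 32 by lra.
by lra.
Qed.

Lemma node_update_of_algorithm (v : V) : exists r eps y wmin wmax,
  node_update e kap theta u (fun w => t (w, l) k - l%:R * Lambda)
    (t (v, l.+1) k - l.+1%:R * Lambda) v r eps y wmin wmax.
Proof.
have [_ Hbounds [r Hr]] := clock (v, l.+1).
have /andP[r1 rt] : 1 <= r <= theta.
  by have := Hbounds 0 1 (lexx _) ltr01; rewrite Hr // subr0 !mulr1.
have r0 : 0 < r by lra.
pose y w := t (w, l) k + delta (w, l) (v, l.+1) - d - l%:R * Lambda.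
(* The local reception time of [w] is [c + r * y w]. *)
pose c := H (v, l.+1) 0 + r * (d + l%:R * Lambda).
have dl w : (w == v) || e v w -> d - u <= delta (w, l) (v, l.+1) <= d.
  by move=> vw; apply: delta_bounds; rewrite /layered_edge /= eqxx.
have Hlin s : 0 <= s -> H (v, l.+1) s = H (v, l.+1) 0 + r * s.
  by move=> s0; have := Hr 0 s (lexx _) s0; rewrite subr0; lra.
have recvE w : (w == v) || e v w -> recv delta H t k v l w = c + r * y w.
  move=> /dl/andP[dw _]; rewrite /recv Hlin; first by rewrite /c /y; ring.
  by rewrite addr_ge0 // (le_trans _ dw) // subr_ge0.
have [w0 evw0] := enbr v.
pose wmin := [arg min_(w < w0 | e v w) y w]%O.
pose wmax := [arg max_(w > w0 | e v w) y w]%O.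
have [emin ymin] : e v wmin /\ forall w, e v w -> y wmin <= y w.
  by rewrite /wmin; case: arg_minP.
have [emax ymax] : e v wmax /\ forall w, e v w -> y w <= y wmax.
  by rewrite /wmax; case: arg_maxP.
have minE : recv_min e delta H t k v l = c + r * y wmin.
  apply: inf_attained.
    by exists wmin => //; rewrite recvE // emin orbT.
  move=> _ [w /= ew <-]; rewrite recvE ?ew ?orbT // lerD2l.
  by rewrite ler_wpM2l ?ymin // ltW.
have maxE : recv_max e delta H t k v l = c + r * y wmax.
  apply: sup_attained.
    by exists wmax => //; rewrite recvE // emax orbT.
  move=> _ [w /= ew <-]; rewrite recvE ?ew ?orbT // lerD2l.
  by rewrite ler_wpM2l ?ymax // ltW.
have ri1 : theta^-1 <= r^-1 by rewrite lef_pV2 ?posrE //; lra.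
have ri2 : r^-1 <= 1 by rewrite invf_le1.
have Ld : 0 <= Lambda - d.
  by have := Lambda_sub_ge; have := L_ge0; have := u_ge0; lra.
(* A local wait of [Lambda - d] takes only [(Lambda - d) / r] of real time, and [eps] is the
   difference. *)
exists r, ((Lambda - d) * (1 - r^-1)), y, wmin, wmax; split=> //.
- by rewrite r1.
- by have := theta_le; lra.
- split; first by rewrite mulr_ge0 // subr_ge0.
  rewrite kappa_half lerD2l mulrC ler_wpM2r //; lra.
- by rewrite ler_wpM2r ?kappa_le // subr_ge0.
- by move=> w /dl/andP[d1 d2]; rewrite /y; apply/andP; split; lra.
- move=> w ew; apply: le_trans drift_skew; rewrite normrM.
  apply: ler_pM => //; first by rewrite ger0_norm; lra.
  have /andP[dv1 dv2] : d - u <= delta (v, l) (v, l.+1) <= d.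
    by apply: dl; rewrite eqxx.
  have /andP[dw1 dw2] : d - u <= delta (w, l) (v, l.+1) <= d.
    by apply: dl; rewrite ew orbT.
  have := L_bound ew; rewrite !ler_norml /y => /andP[tl1 tl2].
  by apply/andP; split; lra.
- rewrite -(correction_shift _ _ c) -minE -maxE -recvE ?eqxx //.
  have := algo v l k; rewrite Hlin ?t_ge0 // recvE ?eqxx // => E.
  set C := correction _ _ _ _ _ in E *.
  have {}E : t (v, l.+1) k = (c - H (v, l.+1) 0 + r * y v + Lambda - d - C) / r.
    by apply: (mulfI (lt0r_neq0 r0)); rewrite [RHS]mulrC divfK ?gt_eqF //; lra.
  by rewrite E /c -natr1; field; rewrite gt_eqF.
Qed.

End Execution.

(** * Extended-real layer skews and pairwise bounds *)

Section LayerSkew.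
Variables (R : realType) (V : finType) (e : rel V) (t : V * nat -> nat -> R).

Lemma layer_skew_ub (l k : nat) (v w : V) : e v w ->
  (`|t (v, l) k - t (w, l) k|%:E <= layer_skew e t l)%E.
Proof.
move=> evw; apply: le_trans; last by apply: ereal_sup_ubound; exists k.
rewrite lee_fin.
exact: (le_bigmax_cond _ (fun p => `|t (p.1, l) k - t (p.2, l) k|)
  (j := (v, w))).
Qed.

Lemma layer_skew_le (l : nat) (B : R) : 0 <= B ->
  (forall k v w, e v w -> `|t (v, l) k - t (w, l) k| <= B) ->
  (layer_skew e t l <= B%:E)%E.
Proof.
move=> B0 H; apply: ge_ereal_sup => _ [k _ <-]; rewrite lee_fin.
by apply: bigmax_le => // -[v w] evw; exact: H.
Qed.

Lemma layer_skew_sup (l : nat) : (layer_skew e t l <= sup_layer_skew e t)%E.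
Proof. by apply: ereal_sup_ubound; exists l. Qed.

Lemma sup_layer_skew_ge0 : (0 <= sup_layer_skew e t)%E.
Proof.
apply: le_trans (layer_skew_sup 0); apply: le_trans; last first.
  by apply: ereal_sup_ubound; exists 0%N.
by rewrite lee_fin; exact: bigmax_ge_id.
Qed.

End LayerSkew.

Theorem theorem1p1 (R : realType) :
  exists C0 : R, 0 < C0 /\
  forall (V : finType) (e : rel V) (D : nat)
    (d u theta Lambda : R)
    (delta : V * nat -> V * nat -> R) (H : V * nat -> R -> R)
    (t : V * nat -> nat -> R),
  symmetric e -> irreflexive e ->
  (forall v w : V, connect e v w) ->
  (forall v : V, (2 <= #|[pred w | e v w]|)%N) ->
  (0 < D)%N -> diameter e = D ->
  0 <= u -> u <= d -> 1 < theta ->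
  (forall x y : V * nat, layered_edge e x y -> d - u <= delta x y <= d) ->
  (forall x : V * nat, hardware_clock theta (H x)) ->
  (forall (x : V * nat) (k : nat), 0 <= t x k) ->
  follows_algorithm e delta H t d u theta Lambda ->
  0 < kappa d u theta Lambda ->
  (layer_skew e t 0 <= (kappa d u theta Lambda)%:E)%E ->
  (C0%:E * (theta%:E * (sup_layer_skew e t + u%:E)) + d%:E <= Lambda%:E)%E ->
  (C0%:E * (theta%:E * (sup_layer_skew e t + u%:E) + (kappa d u theta Lambda)%:E)
     <= d%:E)%E ->
  C0 * (u + (theta - 1) * d) <= d ->
  forall l : nat,
    (layer_skew e t l <= (4 * kappa d u theta Lambda * (2 + log2 D%:R))%:E)%E.
Proof.
exists 32; split=> // V e D d u theta Lambda delta H t esym _ econn edeg D0 eD.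
move=> u0 ud theta1 delta_b clock t0 algo k0 init hLam hd hdrift l.
have theta0 : 0 < theta by lra.
(* The skew supremum is finite, since an infinite one would force the real number [Lambda] to be at
   least [+oo]. *)
have [L L0 SL] : exists2 L : R, 0 <= L & sup_layer_skew e t = L%:E.
  have := sup_layer_skew_ge0 e t; case: (sup_layer_skew e t) hLam => // [L|].
    by exists L.
  by rewrite addye // gt0_muley ?lte_fin // gt0_muley ?lte_fin // addye.
rewrite SL -!(EFinD, EFinM) !lee_fin in hLam hd.
have enbr v : exists w, e v w.
  have : (0 < #|[pred w | e v w]|)%N by rewrite (leq_trans _ (edeg v)).
  by move=> /card_gt0P[w]; exists w.
have skew_L m k v w : e v w -> `|t (v, m) k - t (w, m) k| <= L.
  move=> evw; rewrite -lee_fin -SL.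
  exact: le_trans (layer_skew_ub t m k evw) (layer_skew_sup e t m).
have [s sD] := @log2_levels R D D0.
have main k v w : e v w ->
    t (v, l) k - t (w, l) k <= 4 * kappa d u theta Lambda * (2 + log2 D%:R).
  move=> evw; pose a m x := t (x, m) k - m%:R * Lambda.
  have Lu : 0 <= theta * (L + u) by rewrite mulr_ge0 ?addr_ge0 ?(ltW theta0).
  have : a l v - a l w <=
      4 * kappa d u theta Lambda * ((diameter e)%:R / 2 ^+ s + s%:R + 1 / 2).
    apply: neighbour_skew evw => // [m|x y exy].
      apply: (@gradient_step_nodes _ _ _ _ theta u) => x.
      apply: (node_update_of_algorithm enbr u0 ud theta1 delta_b clock t0 algo
        k0 (skew_L m k) L0) => //; lra.
    have : `|t (x, 0%N) k - t (y, 0%N) k| <= kappa d u theta Lambda.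
      by rewrite -lee_fin (le_trans (layer_skew_ub t 0 k exy)).
    by rewrite ler_norml /a => /andP[]; lra.
  rewrite eD; have /ler_wpM2l : 0 <= 4 * kappa d u theta Lambda by lra.
  by move=> /(_ _ _ sD); rewrite /a; lra.
(* The maximum in the skew starts from [0], so the bound must be shown nonnegative, for which
   [D >= 1] gives [log2 D >= 0]. *)
apply: layer_skew_le => [|k v w evw].
  apply: mulr_ge0; first by lra.
  by rewrite addr_ge0 // divr_ge0 // ln_ge0 // ler1n.
by rewrite ler_norml lerNl opprB !main // esym.
Qed.
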